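(* Let $t$ be an integer with $2\leq t\ll k$ (i.e. $t/k\to 0$). Let $s=s(n)$ and $k=k(n)$ be positive integers and $p=p(n)$ a real number such that (i) $\frac{8(t+1)k^{t+1}s^t\log n}{\binom{n-1}{k-1}}\le p\le 1$, and (ii) $56k^{2+1/t}s \leq n\leq 56k^{2+1/(t-1)}s$. Then with high probability (i.e. with probability tending to $1$ as $n\to\infty$), every non-trivial $\mathcal{F}\subseteq \mathcal{K}_p(n,k)$ with $\nu(\mathcal{F})\leq s$ satisfies $$|\mathcal{F}|< |\mathcal{K}_p(\hat{S})|$$ for some $S\in \binom{[n]}{s}$.
   Context: $\mathcal{K}_p(n,k)$ denotes the Erdős–Rényi random $k$-uniform hypergraph on vertex set $[n]$, each $k$-subset of $[n]$ being an edge independently with probability $p$. For a $k$-graph $\mathcal{F}$, $\nu(\mathcal{F})$ is the maximum number of pairwise disjoint edges, $\tau(\mathcal{F})$ is the minimum size of a vertex set meeting every edge; $\mathcal{F}$ is trivial if $\nu(\mathcal{F})=\tau(\mathcal{F})$ and non-trivial otherwise. For $S\subseteq[n]$, $\mathcal{K}_p(\hat{S})=\{E\in\mathcal{K}_p(n,k)\colon E\cap S\neq\emptyset\}$. $\log$ is the natural logarithm. *)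

(* Defs.v *)
From mathcomp Require Import all_boot all_order all_algebra.

Set Implicit Arguments.
Unset Strict Implicit.
Unset Printing Implicit Defensive.

Import GRing.Theory.

Local Open Scope ring_scope.

Section Hypergraphs.
Variable V : finType.
Implicit Types (F M : {set {set V}}) (S T : {set V}).

Definition complete_hypergraph (k : nat) : {set {set V}} :=
  [set E : {set V} | #|E| == k].

Definition matching_number F : nat :=
  (\max_(M : {set {set V}} | (M \subset F) && trivIset M) #|M|)%N.

Definition is_cover F T : bool := [forall E in F, E :&: T != set0].

(* If F has an empty edge then no cover exists and the value is the default
   #|V|; this cannot occur for k-uniform F with k > 0. *)
Definition cover_number F : nat :=
  #|[arg min_(T < [set: V] | is_cover F T) #|T|]|.

Definition nontrivial F : bool := matching_number F != cover_number F.

Definition edges_meeting F S : {set {set V}} :=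
  [set E in F | E :&: S != set0].

End Hypergraphs.

(* The law of K_p(n,k), as the product measure on the subsets of the set of
   all k-subsets of 'I_n. *)
Definition Kp_weight (R : comNzRingType) (n k : nat) (p : R)
    (G : {set {set 'I_n}}) : R :=
  \prod_(E in complete_hypergraph 'I_n k) (if E \in G then p else 1 - p).

Definition Kp_prob (R : comNzRingType) (n k : nat) (p : R)
    (A : pred {set {set 'I_n}}) : R :=
  \sum_(G : {set {set 'I_n}} | (G \subset complete_hypergraph 'I_n k) && A G)
    Kp_weight k p G.

Lemma sum_subset_prod (R : comNzRingType) (I : finType) (U : {set I})
    (f g : I -> R) :
  \sum_(J : {set I} | J \subset U) \prod_(i in U) (if i \in J then f i else g i)
  = \prod_(i in U) (f i + g i).
Proof.
pose f' i := if i \in U then f i else 0.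
pose g' i := if i \in U then g i else 1.
have -> : \prod_(i in U) (f i + g i) = \prod_i (f' i + g' i).
  rewrite big_mkcond /=; apply: eq_bigr => i _; rewrite /f' /g'.
  by case: ifP => // _; rewrite add0r.
rewrite bigA_distr big_mkcond /=; apply: eq_bigr => J _.
case: ifPn => [sJU|/subsetPn[i iJ iU]].
  rewrite big_mkcond /=; apply: eq_bigr => i _; rewrite /f' /g'.
  case: ifPn => // iU; case: ifP => // iJ.
  by rewrite (subsetP sJU _ iJ) in iU.
by rewrite (bigD1 i) //= iJ /f' (negbTE iU) mul0r.
Qed.

Lemma Kp_prob_total (R : comNzRingType) (n k : nat) (p : R) :
  Kp_prob k p (fun _ : {set {set 'I_n}} => true) = 1.
Proof.
rewrite /Kp_prob; under eq_bigl do rewrite andbT.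
rewrite sum_subset_prod big1 // => E _.
by rewrite addrCA subrr addr0.
Qed.

(* Each k-subset is an edge with probability p, and these events are
   mutually independent. *)
Lemma Kp_prob_superset (R : comNzRingType) (n k : nat) (p : R)
    (A : {set {set 'I_n}}) :
  A \subset complete_hypergraph 'I_n k ->
  Kp_prob k p (fun G => A \subset G) = p ^+ #|A|.
Proof.
move=> sAU; set U := complete_hypergraph _ _ in sAU *.
pose g E : R := if E \in A then 0 else 1 - p.
transitivity (\sum_(G : {set {set 'I_n}} | G \subset U)
    \prod_(E in U) (if E \in G then p else g E)).
  rewrite /Kp_prob big_mkcondr /=; apply: eq_bigr => G _.
  case: ifPn => [sAG|/subsetPn[E EA EG]].
    apply: eq_bigr => E _; case: ifPn => // EG; rewrite /g ifN //.
    by apply: contra EG; apply: (subsetP sAG).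
  by rewrite (bigD1 E) ?(subsetP sAU) //= (negbTE EG) /g EA mul0r.
rewrite sum_subset_prod -prodr_const big_mkcond [RHS]big_mkcond /=.
apply: eq_bigr => E _; rewrite /g.
case: (boolP (E \in A)) => EA; first by rewrite (subsetP sAU) // addr0.
by case: ifP => // _; rewrite addrCA subrr addr0.
Qed.

(* Main.v *)
Require Import Defs.
From mathcomp Require Import all_classical all_reals all_analysis.
From mathcomp Require Import all_boot all_order all_algebra ring lra.

Set Implicit Arguments.
Unset Strict Implicit.
Unset Printing Implicit Defensive.

Import Order.TTheory GRing.Theory Num.Theory numFieldNormedType.Exports.

(** Let nu(F) <= s. Call a set A robust for F if no k s vertices outside A meet
    all edges of F containing A. Pairwise disjoint robust sets can be replaced one
    by one by pairwise disjoint edges, so there are at most s of them; in particular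
    the set T of robust vertices has at most s elements. If F has no cover of size
    s, then #|T| < s, and the edges avoiding T are few: each contains a minimal
    robust set of some size 2 <= i <= t, or has no nonempty robust subset of size at
    most t. Disjoint minimal robust i-sets number at most r = s - #|T|, and a set
    that is not robust has at most k s relevant one-vertex extensions, so the edges
    avoiding T number at most
    r (sum_(2 <= i <= t) i (ks)^(i-1) D_i + k (ks)^t D_(t+1)), where D_i is the
    largest degree of an i-set. Whp D_i <= 3 mu_i + 2 i log n and all vertex degrees
    are at least (2/5) mu_1, where mu_i is the mean; then the bracket is smaller
    than what each vertex added to T gains, and enlarging T to S with #|S| = s wins.
    If F has a cover of size s, enlarged to S with #|S| = s if need be, then
    #|F| >= #|K_p(S^)| would force F = K_p(S^), in which all vertices of S are
    robust, so that nu(F) = tau(F). *)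

(** * Degrees, covers and matchings *)

Lemma leq_card_bigcup (I : Type) (T : finType) (r : seq I) (P : pred I)
    (X : I -> {set T}) :
  #|\bigcup_(i <- r | P i) X i| <= \sum_(i <- r | P i) #|X i|.
Proof.
elim/big_rec2: _ => [|i m A _ Am]; first by rewrite cards0.
by rewrite (leq_trans (leq_card_setU _ _)) // leq_add2l.
Qed.

Lemma trivIset_set1 (T : finType) (S : {set T}) :
  trivIset [set [set x] | x in S] /\ set0 \notin [set [set x] | x in S].
Proof.
have n0 : set0 \notin [set [set x] | x in S].
  by apply/imsetP => -[x _ /setP/(_ x)]; rewrite !inE eqxx.
split=> //; case: (@trivIimset _ _ (mem S) set1) => // x y _ _ nyx.
by rewrite disjoints1 inE eq_sym.
Qed.

Section Hypergraphs.
Variable V : finType.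
Implicit Types (C F G M : {set {set V}}) (A B E S T U W : {set V}).

Definition edges_containing G A : {set {set V}} := [set E in G | A \subset E].

Definition degree G A : nat := #|edges_containing G A|.

Definition max_degree G (i : nat) : nat :=
  \max_(A : {set V} | #|A| == i) degree G A.

Definition edges_over G C : {set {set V}} :=
  [set E in G | [exists A in C, A \subset E]].

Definition edges_avoiding G S : {set {set V}} :=
  [set E in G | [disjoint E & S]].

Lemma degree_le_max_degree G A : degree G A <= max_degree G #|A|.
Proof. exact: (leq_bigmax_cond (F := degree G)). Qed.

Lemma max_degreeS F G i : F \subset G -> max_degree F i <= max_degree G i.
Proof.
move=> FG; apply/bigmax_leqP => A /eqP <-.
apply: leq_trans (degree_le_max_degree G A); apply: subset_leq_card.
by apply/subsetP => E; rewrite !inE => /andP[/(subsetP FG)-> ->].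
Qed.

Lemma card_edges_over_le G C i :
  {in C, forall A, #|A| = i} -> #|edges_over G C| <= #|C| * max_degree G i.
Proof.
move=> Ci.
have : edges_over G C \subset \bigcup_(A in C) edges_containing G A.
  apply/subsetP => E; rewrite inE => /andP[EG /exists_inP[A CA AE]].
  by apply/bigcupP; exists A; rewrite // inE EG.
move/subset_leq_card/leq_trans; apply.
apply: leq_trans (leq_card_bigcup _ _ _) _; rewrite -sum_nat_const.
by apply: leq_sum => A CA; rewrite -(Ci A CA); apply: degree_le_max_degree.
Qed.

Lemma card_edges_meeting_avoiding G S :
  #|edges_meeting G S| + #|edges_avoiding G S| = #|G|.
Proof.
rewrite -(cardsID (edges_avoiding G S) G) addnC.
congr (_ + _); apply: eq_card => E; rewrite !inE.
  by rewrite andbA andbb.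
by rewrite -setI_eq0; case: (E \in G); rewrite ?andbF ?andbT.
Qed.

Lemma card_edges_through_meeting_le G W x : x \notin W ->
  #|edges_meeting (edges_containing G [set x]) W| <= #|W| * max_degree G 2.
Proof.
move=> xW; pose C := [set [set x; y] | y in W].
have sub_over : edges_meeting (edges_containing G [set x]) W \subset edges_over G C.
  apply/subsetP => E; rewrite !inE => /andP[/andP[-> xE] /set0Pn[y]] /=.
  case/setIP => yE yW; apply/exists_inP; exists [set x; y]; first exact: imset_f.
  by rewrite subUset xE sub1set.
apply: leq_trans (subset_leq_card sub_over) _.
apply: leq_trans (card_edges_over_le (i := 2) G _) _.
  move=> _ /imsetP[y yW ->]; rewrite cards2.
  by case: eqP yW xW => // -> ->.
by rewrite leq_mul2r leq_imset_card orbT.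
Qed.

Lemma card_edges_meeting_setU1 G T x : x \notin T ->
  #|edges_meeting G T| + degree G [set x]
    <= #|edges_meeting G (x |: T)| + #|T| * max_degree G 2.
Proof.
move=> xT; pose N := edges_avoiding (edges_containing G [set x]) T.
have NT : [disjoint edges_meeting G T & N].
  rewrite -setI_eq0; apply/eqP/setP => E; rewrite !inE.
  by rewrite setI_eq0; case: [disjoint E & T]; rewrite ?andbF.
have subU : edges_meeting G T :|: N \subset edges_meeting G (x |: T).
  apply/subsetP => E; rewrite !inE => /orP[] /andP[].
    move=> -> /set0Pn[y /setIP[yE yT]]; apply/set0Pn; exists y.
    by rewrite !inE yE yT orbT.
  case/andP=> -> /subsetP/(_ x (set11 x)) xE _; apply/set0Pn; exists x.
  by rewrite !inE xE eqxx.
rewrite /degree -[#|edges_containing _ _|](card_edges_meeting_avoiding _ T).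
rewrite [X in _ + X]addnC addnA.
apply: leq_add; last exact: card_edges_through_meeting_le.
have [_] := leq_card_setU (edges_meeting G T) N; rewrite NT => /eqP <-.
exact: subset_leq_card.
Qed.

(* Each new vertex x gains at least [degree G [set x] - s * max_degree G 2]. *)
Lemma exists_edges_meeting_ge G T s K : s <= #|V| -> #|T| <= s ->
  (forall x, K + s * max_degree G 2 < degree G [set x]) ->
  exists S, [/\ #|S| = s, T \subset S &
    #|edges_meeting G T| + (s - #|T|) * K.+1 <= #|edges_meeting G S|].
Proof.
move=> sV Ts degG; move: {2}(s - #|T|) (erefl (s - #|T|)) => r.
elim: r T Ts => [|r IH] T Ts sT.
  exists T; split=> //; last by rewrite sT addn0.
  by apply/eqP; rewrite eqn_leq Ts -subn_eq0 sT.
have ltTs : #|T| < s by rewrite -subn_gt0 sT.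
have /subsetPn[x _ xT] : ~~ ([set: V] \subset T).
  apply/negP => /subset_leq_card.
  by rewrite cardsT leqNgt (leq_trans ltTs).
have [||S [Ss TS leS]] := IH (x |: T); rewrite ?cardsU1 ?xT //.
  by rewrite add1n subnS sT.
exists S; split=> //; first exact: subset_trans (subsetUr _ _) TS.
apply: leq_trans leS; rewrite sT cardsU1 xT add1n subnS sT /= mulSn addnA.
rewrite leq_add2r -(leq_add2r (#|T| * max_degree G 2)).
apply: leq_trans (card_edges_meeting_setU1 G xT).
rewrite -addnA leq_add2l; apply: leq_trans (degG x).
by rewrite addSn ltnS leq_add2l leq_mul2r (ltnW ltTs) orbT.
Qed.

Lemma leq_card_matching_number F M :
  M \subset F -> trivIset M -> #|M| <= matching_number F.
Proof.
by move=> MF dM; apply: (leq_bigmax_cond (F := fun M => #|M|)); rewrite MF.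
Qed.

Lemma matching_number_le_cover F T :
  is_cover F T -> matching_number F <= #|T|.
Proof.
move=> /forall_inP cT; apply/bigmax_leqP => M /andP[/subsetP MF dM].
have [dMT injMT] : trivIset [set E :&: T | E in M] /\
    {in M &, injective (fun E => E :&: T)}.
  apply: (@trivIimset _ _ (mem M)) => [A B AM BM nBA|].
    apply: disjointWl (subsetIl _ _) _; apply: disjointWr (subsetIl _ _) _.
    by apply: (trivIsetP dM) => //; rewrite eq_sym.
  by apply/imsetP => -[E EM /esym/eqP]; apply/negP/cT/MF.
rewrite -(card_in_imset injMT).
have : cover [set E :&: T | E in M] \subset T.
  by apply/bigcupsP => _ /imsetP[A _ ->]; apply: subsetIr.
move/subset_leq_card; apply: leq_trans.
have [_] := leq_card_cover [set E :&: T | E in M]; rewrite dMT => /eqP->.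
rewrite -sum1_card; apply: leq_sum => _ /imsetP[A AM ->].
by rewrite card_gt0 cT ?MF.
Qed.

Lemma cover_number_le F T : is_cover F T -> cover_number F <= #|T|.
Proof.
move=> cT; rewrite /cover_number.
have [cV|] := boolP (is_cover F setT); first by case: arg_minnP => // U _; apply.
case/forall_inPn => E EF; rewrite setIT negbK => /eqP E0.
by have := forall_inP cT E EF; rewrite E0 set0I eqxx.
Qed.

Lemma exists_min_cover F :
  set0 \notin F -> exists2 T, is_cover F T & #|T| = cover_number F.
Proof.
move=> F0; rewrite /cover_number; case: arg_minnP => [|T cT _]; last by exists T.
by apply/forall_inP => E EF; rewrite setIT; apply: contraNneq F0 => <-.
Qed.

Lemma matching_number_le_cover_number F :
  set0 \notin F -> matching_number F <= cover_number F.
Proof. by case/exists_min_cover => T cT <-; apply: matching_number_le_cover. Qed.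
End Hypergraphs.

(** * Robust sets *)

Section RobustSets.
Variables (V : finType) (F : {set {set V}}) (m : nat).
Implicit Types (C M : {set {set V}}) (A B E S U W : {set V}).

Definition blocks W A : bool :=
  [forall E in edges_containing F A, ~~ [disjoint E & W]].

Definition robust A : bool :=
  [forall W : {set V}, (#|W| <= m) && [disjoint W & A] ==> ~~ blocks W A].

Lemma robustP A :
  reflect (forall W, #|W| <= m -> [disjoint W & A] ->
             exists E, [/\ E \in F, A \subset E & [disjoint E & W]])
          (robust A).
Proof.
apply: (iffP forallP) => [rA W Wm WA | rA W].
  have /implyP := rA W; rewrite Wm WA => /(_ isT) /forall_inPn[E].
  by rewrite inE negbK => /andP[]; exists E.
apply/implyP => /andP[Wm WA]; have [E [EF AE EW]] := rA W Wm WA.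
by apply/forall_inPn; exists E; rewrite ?negbK // inE EF.
Qed.

Lemma robust_edge E : E \in F -> robust E.
Proof. by move=> EF; apply/robustP => W _ WE; exists E; rewrite disjoint_sym. Qed.

Lemma robust_sub_edge A : robust A -> exists2 E, E \in F & A \subset E.
Proof.
move/robustP/(_ set0); rewrite cards0 disjoints_subset sub0set.
by move=> /(_ isT isT)[E [EF AE _]]; exists E.
Qed.

Definition blocker A : {set V} :=
  odflt set0 [pick W : {set V} | [&& #|W| <= m, [disjoint W & A] & blocks W A]].

Lemma card_blocker A : #|blocker A| <= m.
Proof. by rewrite /blocker; case: pickP => [W /and3P[]//|_]; rewrite cards0. Qed.

Lemma disjoint_blocker A : [disjoint blocker A & A].
Proof.
rewrite /blocker; case: pickP => [W /and3P[]//|_].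
by rewrite disjoints_subset sub0set.
Qed.

Lemma robust_meets_blocker A B :
  ~~ robust A -> robust B -> A \subset B -> ~~ [disjoint B & blocker A].
Proof.
case/forallPn => W0; rewrite negb_imply negbK -andbA => W0A.
rewrite /blocker; case: pickP => [W|/(_ W0)]; last by rewrite W0A.
case/and3P=> Wm _ /forall_inP bW /robustP rB AB; apply/negP => BW.
have [||E [EF BE]] := rB W => //; first by rewrite disjoint_sym.
by apply/negP; apply: bW; rewrite inE EF (subset_trans AB).
Qed.

Definition extensions C : {set {set V}} :=
  \bigcup_(A in C) [set x |: A | x in blocker A].

Lemma card_extensions_le C : #|extensions C| <= #|C| * m.
Proof.
apply: leq_trans (leq_card_bigcup _ _ _) _; rewrite -sum_nat_const.
by apply: leq_sum => A _; apply: leq_trans (leq_imset_card _ _) (card_blocker A).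
Qed.

Lemma extensions_uniform C j :
  {in C, forall A, #|A| = j} -> {in extensions C, forall A, #|A| = j.+1}.
Proof.
move=> Cj _ /bigcupP[A CA /imsetP[x xA ->]].
by rewrite cardsU1 (Cj A CA) (disjointFr (disjoint_blocker A) xA).
Qed.

Definition robust_beyond j B : bool :=
  [&& robust B, B != set0 &
    [forall A : {set V}, [&& A \subset B, A != set0 & #|A| <= j] ==> ~~ robust A]].

Lemma robust_beyondP j B :
  reflect [/\ robust B, B != set0
             & forall A, A \subset B -> A != set0 -> #|A| <= j -> ~~ robust A]
          (robust_beyond j B).
Proof.
apply: (iffP and3P) => -[rB B0 nB]; split=> //.
  by move=> A AB A0 Aj; apply: (implyP (forallP nB A)); apply/and3P.
by apply/forallP => A; apply/implyP => /and3P[]; apply: nB.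
Qed.

Lemma robust_beyondW i j B : i <= j -> robust_beyond j B -> robust_beyond i B.
Proof.
move=> ij /robust_beyondP[rB B0 nB]; apply/robust_beyondP; split=> // A AB A0 Ai.
exact: nB (leq_trans Ai ij).
Qed.

(* Grow sets inside the members of H one vertex at a time: a set that is not
   robust has at most m relevant extensions, the vertices of its blocker. *)
Lemma robust_beyond_branching C U j :
  {in C, forall B, robust_beyond j B /\ ~~ [disjoint B & U]} ->
  exists2 D : {set {set V}}, #|D| <= #|U| * m ^ j /\ {in D, forall A, #|A| = j.+1}
    & {in C, forall B, exists2 A, A \in D & A \subset B}.
Proof.
elim: j => [|j IH] CB.
  exists [set [set x] | x in U] => [|B /CB[_ /pred0Pn[x /= /andP[xB xU]]]].
    by rewrite muln1 leq_imset_card; split=> // _ /imsetP[x _ ->]; rewrite cards1.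
  by exists [set x]; rewrite ?sub1set //; apply: imset_f.
have [|D [Dle Dj] DC] := IH.
  by move=> B /CB[rB ?]; split=> //; apply: robust_beyondW rB.
exists (extensions D) => [|B BC].
  split; last exact: extensions_uniform.
  by apply: leq_trans (card_extensions_le D) _; rewrite expnSr mulnA leq_mul.
have [A DA AB] := DC B BC; have [/robust_beyondP[rB _ nB] _] := CB B BC.
have nA : ~~ robust A by apply: nB; rewrite ?(Dj A DA) // -card_gt0 (Dj A DA).
have /pred0Pn[x /= /andP[xB xA]] := robust_meets_blocker nA rB AB.
exists (x |: A); last by rewrite subUset sub1set xB.
by apply/bigcupP; exists A => //; apply: imset_f.
Qed.

Definition robust_vertices : {set V} := [set x | robust [set x]].

Lemma robust_beyond_disjoint j B :
  0 < j -> robust_beyond j B -> [disjoint B & robust_vertices].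
Proof.
move=> j0 /robust_beyondP[_ _ nB]; rewrite disjoint_subset.
apply/subsetP => x xB; rewrite !inE; apply: nB; rewrite ?sub1set ?cards1 //.
by rewrite -card_gt0 cards1.
Qed.

(* Consider a smallest nonempty robust subset of E. *)
Lemma edge_avoiding_robust_vertices t E :
  E \in F -> E != set0 -> [disjoint E & robust_vertices] ->
  robust_beyond t E \/
    exists i B, [/\ 0 < i < t, #|B| = i.+1, robust_beyond i B & B \subset E].
Proof.
move=> EF E0 dE; pose P B := [&& B \subset E, B != set0 & robust B].
have PE : P E by rewrite /P subxx E0; apply: robust_edge.
case: (arg_minnP (fun B => #|B|) PE) => B /and3P[BE B0 rB] Bmin.
have nB A : A \subset E -> A != set0 -> #|A| < #|B| -> ~~ robust A.
  move=> AE A0; rewrite ltnNge; apply: contra => rA; apply: Bmin.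
  by rewrite /P AE A0.
have [Bt|tB] := leqP #|B| t; [right|left]; last first.
  apply/robust_beyondP; split=> // [|A AE A0 At]; first exact: robust_edge.
  by apply: nB => //; apply: leq_ltn_trans tB.
case eB: #|B| => [|[|i]]; first by rewrite -cards_eq0 eB in B0.
  have /cards1P[x Bx] : #|B| == 1 by rewrite eB.
  by move: rB (disjointWl BE dE); rewrite Bx disjoints1 inE => ->.
exists i.+1, B; split=> //; first by rewrite -eB.
apply/robust_beyondP; split=> // A AB A0 Ai.
by apply: nB; rewrite ?eB // (subset_trans AB).
Qed.

Lemma robust_family_exchange k M B :
  {in F, forall E, #|E| <= k} -> trivIset M -> set0 \notin M ->
  {in M, forall A, robust A} -> k * #|M|.-1 <= m -> B \in M ->
  exists E, [/\ E \in F, B \subset E, E \notin M :\ B & trivIset (E |: (M :\ B))].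
Proof.
move=> Fk dM M0 rM kM BM.
have M0B : set0 \notin M :\ B by rewrite inE (negbTE M0) andbF.
have Wm : #|cover (M :\ B)| <= m.
  apply: leq_trans kM; rewrite (cardsD1 B M) BM mulnC -sum_nat_const.
  apply: leq_trans (leq_card_cover _) _; apply: leq_sum => C /setD1P[_ /rM].
  by case/robust_sub_edge => E /Fk kE /subset_leq_card/leq_trans; apply.
have [|E [EF BE EW]] := robustP _ (rM B BM) _ Wm.
  by rewrite coverD1 // disjoint_sym disjoints_subset setCD subsetUr.
have [C CM|dE EM] := @trivIsetU1 _ E _ _ (trivIsetD [set B] dM) M0B; last first.
  by exists E.
by apply: disjointWr EW; apply: bigcup_sup CM.
Qed.

Lemma robust_family_le_matching_number k M :
  {in F, forall E, #|E| <= k} -> trivIset M -> set0 \notin M ->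
  {in M, forall B, robust B} -> k * #|M|.-1 <= m ->
  #|M| <= matching_number F.
Proof.
move=> Fk; have [r] := ubnP #|M :\: F|.
elim: r M => // r IH M ltMr dM M0 rM kM.
case: (boolP (M \subset F)) => [MF|]; first exact: leq_card_matching_number.
case/subsetPn => B BM BF.
have [E [EF BE EM dEM]] := robust_family_exchange Fk dM M0 rM kM BM.
have cME : #|E |: (M :\ B)| = #|M| by rewrite cardsU1 EM (cardsD1 B M) BM.
rewrite -cME; apply: IH => //.
- rewrite -ltnS; apply: leq_trans ltMr; rewrite ltnS; apply: proper_card.
  have neBE : B != E by apply: contraNneq BF => ->.
  apply/properP; split; last first.
    by exists B; rewrite !inE ?BM ?BF // eqxx (negbTE neBE).
  apply/subsetP => C; rewrite !inE => /andP[CF /predU1P[eCE|/andP[_ ->]]].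
    by rewrite eCE EF in CF.
  by rewrite CF.
- rewrite in_setU1 in_setD1 negb_or negb_and M0 orbT andbT.
  by apply: contraNneq M0 => E0; have := BE; rewrite -E0 subset0 => /eqP <-.
- by move=> C /setU1P[->|/setD1P[_ /rM]//]; apply: robust_edge.
- by rewrite cME.
Qed.
End RobustSets.

(** * Hypergraphs of bounded matching number *)

Section BoundedMatching.
Variables (V : finType) (F : {set {set V}}) (k s : nat).
Implicit Types (C M : {set {set V}}) (A B E U : {set V}).
Hypotheses (F0 : set0 \notin F) (Fk : {in F, forall E, #|E| <= k})
  (nuF : matching_number F <= s).
Local Notation m := (k * s).
Local Notation rob := (robust F m).
Local Notation core := (robust_vertices F m).

Lemma card_robust_family_le M :
  trivIset M -> set0 \notin M -> {in M, forall B, rob B} -> #|M| <= s.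
Proof.
move=> dM M0 rM; rewrite leqNgt; apply/negP => ltsM.
have /card_gt0P[N] : 0 < #|[set N : {set {set V}} | N \subset M & #|N| == s.+1]|.
  by rewrite cards_draws bin_gt0.
rewrite inE => /andP[NM /eqP cN].
suff : #|N| <= matching_number F by rewrite cN ltnNge nuF.
apply: (robust_family_le_matching_number (m := m)) Fk (trivIsetS NM dM) _ _ _.
- by apply: contra M0 => /(subsetP NM).
- by move=> B /(subsetP NM)/rM.
- by rewrite cN.
Qed.

Lemma card_robust_family_avoiding_le M :
  trivIset M -> set0 \notin M ->
  {in M, forall B, rob B /\ [disjoint B & core]} -> #|M| + #|core| <= s.
Proof.
move=> dM M0 rM; have [dT T0] := trivIset_set1 core.
rewrite -[#|core|](card_imset _ set1_inj).
have dMT : [disjoint cover M & cover [set [set x] | x in core]].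
  apply: bigcup_disjoint => _ /imsetP[x xT ->]; rewrite disjoint_sym disjoints1.
  by apply/bigcupP => -[B /rM[_ dB] xB]; rewrite (disjointFr dB xB) in xT.
have MT : [disjoint M & [set [set x] | x in core]].
  rewrite disjoint_subset; apply/subsetP => B BM; rewrite inE.
  apply: contraL BM => /imsetP[x xT ->]; apply/negP => /rM[_].
  by rewrite disjoints1 xT.
have [_] := leq_card_setU M [set [set x] | x in core]; rewrite MT => /eqP <-.
apply: card_robust_family_le; first exact: trivIsetU.
  by rewrite in_setU negb_or M0.
by move=> B /setUP[/rM[]//|/imsetP[x xT ->]]; rewrite inE in xT.
Qed.

Lemma card_robust_vertices_le : #|core| <= s.
Proof.
have := @card_robust_family_avoiding_le set0; rewrite cards0; apply=> [||B].
- by apply/trivIsetP => A; rewrite inE.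
- by rewrite inE.
- by rewrite inE.
Qed.

(* The union of a maximal disjoint subfamily is a transversal. *)
Lemma exists_robust_transversal h C :
  {in C, forall B, [/\ rob B, B != set0, #|B| <= h & [disjoint B & core]]} ->
  exists2 U : {set V}, #|U| <= h * (s - #|core|)
    & {in C, forall B, ~~ [disjoint B & U]}.
Proof.
move=> rC; pose P M := (M \subset C) && trivIset M.
have P0 : P set0 by rewrite /P sub0set; apply/trivIsetP => A; rewrite inE.
have [M /maxsetP[/andP[/subsetP MC dM] Mmax] _] := maxset_exists P0.
have M0 : set0 \notin M by apply/negP => /MC/rC[_]; rewrite eqxx.
exists (cover M) => [|B BC]; last first.
  apply/negP => dB; have [|dBM BM] := @trivIsetU1 _ B M _ dM M0.
    by move=> A AM; apply: disjointWr dB; apply: bigcup_sup AM.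
  case/negP: BM; have <- : B |: M = M; last exact: setU11.
  apply: Mmax; last exact: subsetUr.
  by rewrite /P dBM andbT subUset sub1set BC; apply/subsetP.
have Ms : #|M| <= s - #|core|.
  rewrite leq_subRL ?card_robust_vertices_le // addnC.
  by apply: card_robust_family_avoiding_le => // B /MC/rC[].
rewrite mulnC; apply: leq_trans (leq_mul Ms (leqnn h)).
apply: leq_trans (leq_card_cover M) _; rewrite -sum_nat_const.
by apply: leq_sum => A /MC/rC[].
Qed.

Lemma card_edges_over_robust_beyond_le h j C : 0 < j ->
  {in C, forall B, robust_beyond F m j B /\ #|B| <= h} ->
  #|edges_over F C| <= (s - #|core|) * (h * m ^ j * max_degree F j.+1).
Proof.
move=> j0 rC; have [B /rC[rB Bh]|U Uh CU] := @exists_robust_transversal h C.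
  have dB := robust_beyond_disjoint j0 rB.
  by case/robust_beyondP: rB.
have [|D [Dle Dj] DC] := @robust_beyond_branching _ F m C U j.
  by move=> B BC; split; [case: (rC B BC) | apply: CU].
have : edges_over F C \subset edges_over F D.
  apply/subsetP => E; rewrite !inE => /andP[-> /exists_inP[B BC BE]].
  have [A DA AB] := DC B BC; apply/exists_inP; exists A => //.
  exact: subset_trans BE.
move/subset_leq_card/leq_trans; apply.
apply: leq_trans (card_edges_over_le F Dj) _.
rewrite !mulnA leq_mul // (leq_trans Dle) // leq_mul //.
by rewrite mulnC.
Qed.

(* Bounds the number of edges avoiding the robust vertices, per unit of the defect
   [s - #|core|]; [D i] stands for the maximum degree of an i-set. *)
Definition avoidance_bound t (D : nat -> nat) : nat :=
  \sum_(1 <= i < t) i.+1 * m ^ i * D i.+1 + k * m ^ t * D t.+1.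

Lemma card_edges_avoiding_robust_vertices_le t : 0 < t ->
  #|edges_avoiding F core| <= (s - #|core|) * avoidance_bound t (max_degree F).
Proof.
move=> t0.
pose C i := [set B : {set V} | (#|B| == i.+1) && robust_beyond F m i B].
pose Ct := [set E in F | robust_beyond F m t E].
have sub_over : edges_avoiding F core \subset
    \bigcup_(1 <= i < t) edges_over F (C i) :|: edges_over F Ct.
  apply/subsetP => E; rewrite inE => /andP[EF dE]; rewrite inE.
  have E0 : E != set0 by apply: contraNneq F0 => <-.
  have [rE|[i [B [it Bi rB BE]]]] := edge_avoiding_robust_vertices t EF E0 dE.
    apply/orP; right; rewrite inE EF; apply/exists_inP; exists E => //.
    by rewrite inE EF.
  rewrite (big_rem i) ?mem_index_iota //= !inE EF /=.
  apply/orP; left; apply/orP; left; apply/exists_inP; exists B => //.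
  by rewrite inE Bi eqxx.
apply: leq_trans (subset_leq_card sub_over) _.
apply: leq_trans (leq_card_setU _ _) _; rewrite mulnDr; apply: leq_add.
  apply: leq_trans (leq_card_bigcup _ _ _) _; rewrite big_distrr /=.
  rewrite !big_nat; apply: leq_sum => i /andP[i0 _].
  apply: card_edges_over_robust_beyond_le i0 _ => B.
  by rewrite inE => /andP[/eqP->].
apply: card_edges_over_robust_beyond_le t0 _ => E.
by rewrite inE => /andP[/Fk].
Qed.
End BoundedMatching.

(** * Non-trivial subhypergraphs *)

Lemma avoidance_boundS k s t (D D' : nat -> nat) :
  (forall i, D i <= D' i) -> avoidance_bound k s t D <= avoidance_bound k s t D'.
Proof.
by move=> DD'; apply: leq_add; [apply: leq_sum => i _ |]; rewrite leq_mul.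
Qed.

Definition nontrivial_beaten (V : finType) (s : nat) (G : {set {set V}}) : bool :=
  [forall F : {set {set V}},
    [&& F \subset G, nontrivial F & (matching_number F <= s)] ==>
    [exists S : {set V}, (#|S| == s) && (#|F| < #|edges_meeting G S|)]].

Section Comparison.
Variables (V : finType) (G : {set {set V}}) (k s : nat).
Implicit Types (F : {set {set V}}) (E S T : {set V}).
Hypotheses (G0 : set0 \notin G) (Gk : {in G, forall E, #|E| <= k})
  (sV : s <= #|V|).

Lemma robust_set1_edges_meeting S m x : x \in S ->
  m * max_degree G 2 < degree G [set x] -> robust (edges_meeting G S) m [set x].
Proof.
move=> xS deg_x; apply/robustP => W Wm; rewrite disjoint_sym disjoints1 => xW.
have : 0 < #|edges_avoiding (edges_containing G [set x]) W|.
  rewrite -(ltn_add2l #|edges_meeting (edges_containing G [set x]) W|) addn0.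
  rewrite card_edges_meeting_avoiding; apply: leq_ltn_trans deg_x.
  apply: leq_trans (card_edges_through_meeting_le G xW) _.
  by rewrite leq_mul2r Wm orbT.
case/card_gt0P => E; rewrite !inE sub1set => /andP[/andP[EG xE] EW].
exists E; split; rewrite ?sub1set // inE EG; apply/set0Pn; exists x.
by rewrite inE xE.
Qed.

Lemma card_le_matching_number_edges_meeting S :
  {in S, forall x, k * #|S| * max_degree G 2 < degree G [set x]} ->
  #|S| <= matching_number (edges_meeting G S).
Proof.
move=> degS; have [dS S0] := trivIset_set1 S.
rewrite -(card_imset _ set1_inj) /=.
apply: (robust_family_le_matching_number (m := k * #|S|) (k := k)) => //.
- by move=> E; rewrite inE => /andP[/Gk].
- by move=> _ /imsetP[x xS ->]; apply: robust_set1_edges_meeting (degS x xS).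
- by rewrite card_imset ?leq_mul2l ?leq_pred ?orbT //; apply: set1_inj.
Qed.

Lemma nontrivial_covered_lt_edges_meeting F :
  (forall x, k * s * max_degree G 2 + s * max_degree G 2 < degree G [set x]) ->
  F \subset G -> nontrivial F -> cover_number F <= s ->
  exists2 S : {set V}, #|S| = s & #|F| < #|edges_meeting G S|.
Proof.
move=> degG FG ntF tauF.
have F0 : set0 \notin F by apply: contra G0 => /(subsetP FG).
have [T cT eT] := exists_min_cover F0.
rewrite -eT in tauF; have [S [Ss TS _]] := exists_edges_meeting_ge sV tauF degG.
exists S => //; rewrite ltnNge; apply/negP => le_SF.
have FS : F \subset edges_meeting G S.
  apply/subsetP => E EF; rewrite inE (subsetP FG) //=.
  apply: contra (forall_inP cT E EF); rewrite -!subset0.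
  exact/subset_trans/setIS.
have eF : F = edges_meeting G S by apply/eqP; rewrite eqEcard FS.
case/negP: ntF; rewrite eqn_leq matching_number_le_cover_number //=.
rewrite -eT {1}eF; apply: leq_trans tauF _; rewrite -Ss.
apply: card_le_matching_number_edges_meeting => x _; rewrite Ss.
by apply: leq_ltn_trans (degG x); apply: leq_addr.
Qed.

Lemma uncovered_lt_edges_meeting F t : 0 < t ->
  (forall x, avoidance_bound k s t (max_degree G) + s * max_degree G 2
     < degree G [set x]) ->
  F \subset G -> matching_number F <= s < cover_number F ->
  exists2 S : {set V}, #|S| = s & #|F| < #|edges_meeting G S|.
Proof.
move=> t0 degG FG /andP[nuF tauF]; set K := avoidance_bound _ _ _ _ in degG.
have F0 : set0 \notin F by apply: contra G0 => /(subsetP FG).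
have Fk : {in F, forall E, #|E| <= k} by move=> E /(subsetP FG)/Gk.
pose T := robust_vertices F (k * s).
have [E EF dE] : exists2 E, E \in F & [disjoint E & T].
  have : ~~ is_cover F T.
    apply: contraL tauF => /cover_number_le; rewrite -leqNgt => /leq_trans; apply.
    exact: card_robust_vertices_le.
  by case/forall_inPn => E EF; rewrite negbK setI_eq0; exists E.
have ltTs : #|T| < s.
  have := @card_robust_family_avoiding_le _ F k s Fk nuF [set E].
  rewrite cards1 add1n; apply=> [||B /set1P->]; first exact: trivIset1.
    by rewrite inE eq_sym; apply: contraNneq F0 => <-.
  by split=> //; apply: robust_edge.
have [S [Ss TS leS]] := exists_edges_meeting_ge sV (ltnW ltTs) degG.
exists S => //; apply: leq_trans leS; rewrite mulnS [X in _ < _ + X]addnC addnA.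
apply: (@leq_ltn_trans (#|edges_meeting G T| + (s - #|T|) * K)); last first.
  by rewrite -[X in X < _]addn0 ltn_add2l subn_gt0.
rewrite -(card_edges_meeting_avoiding F T); apply: leq_add.
  apply/subset_leq_card/subsetP => A.
  by rewrite !inE => /andP[/(subsetP FG)->].
apply: leq_trans (card_edges_avoiding_robust_vertices_le F0 Fk nuF t0) _.
by rewrite leq_mul2l avoidance_boundS ?orbT // => i; apply: max_degreeS.
Qed.

Lemma degree_gt_nontrivial_beaten t : 1 < t ->
  (forall x, avoidance_bound k s t (max_degree G) + s * max_degree G 2
     < degree G [set x]) ->
  nontrivial_beaten s G.
Proof.
move=> t1 degG; apply/forallP => F; apply/implyP => /and3P[FG ntF nuF].
suff [S Ss ltS] : exists2 S : {set V}, #|S| = s & #|F| < #|edges_meeting G S|.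
  by apply/existsP; exists S; rewrite Ss eqxx.
have [tauF|tauF] := leqP (cover_number F) s.
  apply: nontrivial_covered_lt_edges_meeting => // x.
  apply: leq_ltn_trans (degG x); rewrite leq_add2r /avoidance_bound big_ltn //.
  by rewrite expn1 mulSn mul1n mulnDl -!addnA leq_addr.
by apply: uncovered_lt_edges_meeting (ltnW t1) degG FG _; rewrite nuF.
Qed.
End Comparison.

Local Open Scope ring_scope.

(** * Exponential moments in the random hypergraph *)

Lemma degree_complete_hypergraph (V : finType) (k : nat) (A : {set V}) :
  (#|A| <= k)%N ->
  degree (complete_hypergraph V k) A = 'C(#|V| - #|A|, k - #|A|).
Proof.
move=> Ak; have <- : #|~: A| = (#|V| - #|A|)%N by rewrite cardsCs setCK.
rewrite -cards_draws; set X := [set B : {set V} | B \subset _ & _].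
have dX B : B \in X -> [disjoint B & A] by rewrite inE -disjoints_subset => /andP[].
have addAK B : B \in X -> (B :|: A) :\: A = B.
  by move=> /dX dB; rewrite setDUl setDv setU0; apply/setDidPl.
have injA : {in X &, injective (fun B => B :|: A)}.
  by move=> B C BX CX /= eBC; rewrite -(addAK B BX) eBC addAK.
rewrite -(card_in_imset injA); apply: eq_card => E.
apply/idP/imsetP => [|[B BX ->]].
  rewrite !inE => /andP[/eqP Ek AE]; exists (E :\: A); last first.
    by rewrite -{1}(setID E A) (setIidPr AE) setUC.
  by rewrite inE subsetDr cardsD (setIidPr AE) Ek eqxx.
have dB := dX B BX; move: BX; rewrite !inE subsetUr andbT => /andP[_ /eqP Bk].
by have [_] := leq_card_setU B A; rewrite dB => /eqP->; rewrite Bk subnK.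
Qed.

Lemma edges_containing_setIE (V : finType) (G H : {set {set V}}) (A : {set V}) :
  G \subset H -> edges_containing G A = edges_containing H A :&: G.
Proof.
move=> /subsetP GH; apply/setP => E; rewrite !inE andbC [RHS]andbC.
by case: (boolP (E \in G)) => [/GH->|]; rewrite ?andbT ?andbF.
Qed.

Lemma sum_expr_card_subset (R : comNzRingType) (T : finType) (x : R) :
  \sum_(A : {set T}) x ^+ #|A| = (1 + x) ^+ #|T|.
Proof.
rewrite addrC -cardsT -prodr_const -(sum_subset_prod _ (fun=> x)).
apply: eq_big => [A|A _]; first by rewrite subsetT.
by rewrite -big_mkcondr -prodr_const; apply: eq_bigl => i; rewrite inE.
Qed.

Section KpMoments.
Variables (R : comNzRingType) (n k : nat) (p : R).
Let H := complete_hypergraph 'I_n k.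

Lemma Kp_prob_predC (A : pred {set {set 'I_n}}) :
  Kp_prob k p A = 1 - Kp_prob k p (predC A).
Proof.
rewrite -(Kp_prob_total n k p) /Kp_prob [X in _ = X - _](bigID A) /=.
under [X in X + _ - _]eq_bigl do rewrite andbT.
under [X in _ + X - _]eq_bigl do rewrite andbT.
by rewrite addrK.
Qed.

Lemma Kp_mgf (U : {set {set 'I_n}}) (z : R) : U \subset H ->
  \sum_(G : {set {set 'I_n}} | G \subset H) z ^+ #|U :&: G| * Kp_weight k p G
  = (1 + p * (z - 1)) ^+ #|U|.
Proof.
move=> UH.
transitivity (\sum_(G : {set {set 'I_n}} | G \subset H)
    \prod_(E in H) (if E \in G then p * (if E \in U then z else 1) else 1 - p)).
  apply: eq_bigr => G GH; rewrite -prodr_const /Kp_weight.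
  rewrite [X in X * _](_ : _ = \prod_(E in H) (if E \in U :&: G then z else 1)).
    rewrite -big_split /=; apply: eq_bigr => E _; rewrite inE.
    by case: (E \in U); case: (E \in G) => /=; rewrite ?mulr1 ?mul1r // mulrC.
  rewrite -big_mkcondr /=; apply: eq_bigl => E; rewrite !inE.
  by case: (boolP (E \in U)) => [/(subsetP UH)|]; rewrite ?inE ?andbF // => ->.
rewrite sum_subset_prod -prodr_const big_mkcond [RHS]big_mkcond /=.
apply: eq_bigr => E _; case: (boolP (E \in U)) => EU.
  by rewrite (subsetP UH) // mulrBr mulr1 addrCA addrA.
by case: ifP => // _; rewrite mulr1 addrCA subrr addr0.
Qed.
End KpMoments.

Section KpOrder.
Variables (R : numDomainType) (n k : nat) (p : R).
Hypothesis p01 : 0 <= p <= 1.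
Let H := complete_hypergraph 'I_n k.
Implicit Types (G : {set {set 'I_n}}) (A B : pred {set {set 'I_n}}).

Lemma Kp_weight_ge0 G : 0 <= Kp_weight k p G.
Proof.
by case/andP: p01 => p0 p1; apply: prodr_ge0 => E _; case: ifP; rewrite ?subr_ge0.
Qed.

Lemma Kp_prob_le1 A : Kp_prob k p A <= 1.
Proof.
by rewrite Kp_prob_predC gerBl; apply: sumr_ge0 => G _; apply: Kp_weight_ge0.
Qed.

Lemma Kp_prob_union (I : finType) (Q : pred I) A (B : I -> pred {set {set 'I_n}}) :
  (forall G, G \subset H -> A G -> exists2 i, Q i & B i G) ->
  Kp_prob k p A <= \sum_(i | Q i) Kp_prob k p (B i).
Proof.
move=> AB; rewrite /Kp_prob.
under [X in _ <= X]eq_bigr do rewrite big_mkcondr /=.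
rewrite exchange_big /= big_mkcondr /=; apply: ler_sum => G GH.
have term_ge0 i : 0 <= (if B i G then Kp_weight k p G else 0).
  by case: ifP => // _; apply: Kp_weight_ge0.
case: ifPn => AG; last by apply: sumr_ge0 => i _; apply: term_ge0.
have [i Qi Bi] := AB G GH AG; rewrite (bigD1 i) //= Bi lerDl.
by apply: sumr_ge0 => j _; apply: term_ge0.
Qed.

Lemma Kp_prob_le A B : (forall G, G \subset H -> A G -> B G) ->
  Kp_prob k p A <= Kp_prob k p B.
Proof.
move=> AB; have := @Kp_prob_union unit predT A (fun=> B).
rewrite big_const card_unit /= addr0; apply=> G GH AG.
by exists tt => //; apply: AB.
Qed.
End KpOrder.

Lemma expR1_le4 (R : realType) : expR 1 <= 4 :> R.
Proof.
have half_le : 1 / 2 <= expR (- (1 / 2)) :> R.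
  by have := expR_ge1Dx (- (1 / 2) : R); lra.
have : (1 / 2) ^+ 2 <= expR (- (1 / 2)) ^+ 2 :> R.
  by rewrite lerXn2r ?nnegrE ?expR_ge0 //; lra.
rewrite -expRM_natl (_ : 2 * _ = - 1) ?expRN; last by field.
by rewrite (_ : (1 / 2) ^+ 2 = 4^-1 :> R) ?lef_pV2 ?posrE ?expR_gt0 //; field.
Qed.

Section DegreeTails.
Variables (R : realType) (n k : nat) (p : R).
Hypothesis p01 : 0 <= p <= 1.
Let H := complete_hypergraph 'I_n k.
Implicit Types (G U : {set {set 'I_n}}) (A : {set 'I_n}).

Lemma Kp_chernoff U (a x : R) : U \subset H ->
  Kp_prob k p (fun G => 0 <= a * (#|U :&: G|%:R - x))
    <= expR (p * #|U|%:R * (expR a - 1) - a * x).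
Proof.
case/andP: (p01) => p0 p1 UH.
apply: (@le_trans _ _ (expR (- (a * x)) * (1 + p * (expR a - 1)) ^+ #|U|)).
  rewrite -(Kp_mgf p (expR a) UH) mulr_sumr /Kp_prob big_mkcondr /=.
  apply: ler_sum => G _; rewrite mulrA -expRM_natl -expRD.
  rewrite (_ : - (a * x) + _ = a * (#|U :&: G|%:R - x)); last by ring.
  case: ifP => [ev|_]; last by rewrite mulr_ge0 ?expR_ge0 ?Kp_weight_ge0.
  by rewrite ler_peMl ?Kp_weight_ge0 // -[X in X <= _]expR0 ler_expR.
rewrite [_ * (expR a - 1) - _]addrC expRD ler_wpM2l ?expR_ge0 //.
rewrite (_ : p * _ * _ = #|U|%:R * (p * (expR a - 1))); last by ring.
rewrite expRM_natl lerXn2r ?nnegrE ?expR_ge0 ?expR_ge1Dx //.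
by have := expR_ge0 a; nra.
Qed.

Definition mean_degree (i : nat) : R := p * 'C(n - i, k - i)%:R.

Lemma mean_degree_ge0 i : 0 <= mean_degree i.
Proof. by case/andP: p01 => p0 _; rewrite mulr_ge0. Qed.

Lemma Kp_degree_chernoff A (a x : R) : (#|A| <= k)%N ->
  Kp_prob k p (fun G => 0 <= a * ((degree G A)%:R - x))
    <= expR (mean_degree #|A| * (expR a - 1) - a * x).
Proof.
move=> Ak; have UH : edges_containing H A \subset H.
  by apply/subsetP => E; rewrite inE => /andP[].
have := Kp_chernoff a x UH; rewrite -/(degree H A) degree_complete_hypergraph //.
rewrite card_ord; apply: le_trans; apply: Kp_prob_le => // G GH.
by rewrite /degree (edges_containing_setIE A GH).
Qed.

Lemma Kp_degree_upper_tail A (y : R) : (#|A| <= k)%N ->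
  Kp_prob k p (fun G => 3 * mean_degree #|A| + y < (degree G A)%:R) <= expR (- y).
Proof.
move=> Ak; set mu := mean_degree #|A|.
apply: (@le_trans _ _ (expR (mu * (expR 1 - 1) - 1 * (3 * mu + y)))).
  apply: le_trans (Kp_degree_chernoff 1 (3 * mu + y) Ak).
  apply: Kp_prob_le => // G _.
  by rewrite mul1r subr_ge0; apply: ltW.
rewrite ler_expR; have := mean_degree_ge0 #|A|; rewrite -/mu.
by have := expR1_le4 R; nra.
Qed.

Lemma Kp_degree_lower_tail A : (#|A| <= k)%N ->
  Kp_prob k p (fun G => (degree G A)%:R < 2 / 5 * mean_degree #|A|)
    <= expR (- (mean_degree #|A| / 10)).
Proof.
move=> Ak; set mu := mean_degree #|A|.
apply: (@le_trans _ _ (expR (mu * (expR (- 1) - 1) - - 1 * (2 / 5 * mu)))).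
  apply: le_trans (Kp_degree_chernoff (- 1) (2 / 5 * mu) Ak).
  apply: Kp_prob_le => // G _ ltG.
  by rewrite mulN1r opprB subr_ge0 ltW.
have half_ge : expR (- 1) <= 1 / 2 :> R.
  rewrite expRN div1r lef_pV2 ?posrE ?expR_gt0 //.
  by have := expR_ge1Dx (1 : R); lra.
by rewrite ler_expR; have := mean_degree_ge0 #|A|; rewrite -/mu; nra.
Qed.

(* The deviation is chosen so that an i-set exceeds its cap with probability at
   most n^(-2i), which is summable over all nonempty sets. *)
Definition degree_cap (i : nat) : R :=
  3 * mean_degree i + 2 * i%:R * ln n%:R.

Definition typical_degree G A : bool :=
  if #|A| == 1%N then 2 / 5 * mean_degree 1 <= (degree G A)%:R
  else (degree G A)%:R <= degree_cap #|A|.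

Definition typical_degrees (t : nat) G : bool :=
  [forall A : {set 'I_n}, (0 < #|A| <= t.+1)%N ==> typical_degree G A].

Lemma typical_degreesP t G A :
  typical_degrees t G -> (0 < #|A| <= t.+1)%N -> typical_degree G A.
Proof. by move=> /forallP/(_ A)/implyP. Qed.

Hypothesis mean_ge : 20 * ln n%:R <= mean_degree 1.

Lemma Kp_prob_atypical_degree_le A : (#|A| <= k)%N -> A != set0 ->
  Kp_prob k p (fun G => ~~ typical_degree G A) <= (n%:R ^- 2) ^+ #|A|.
Proof.
move=> Ak /set0Pn[x _].
have n0 : 0 < n%:R :> R by rewrite ltr0n (leq_ltn_trans _ (ltn_ord x)).
have -> : (n%:R ^- 2) ^+ #|A| = expR (- (2 * #|A|%:R * ln n%:R)) :> R.
  rewrite (_ : - _ = #|A|%:R * (2 * - ln n%:R)); last by ring.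
  by rewrite !expRM_natl expRN lnK ?posrE // -exprVn.
rewrite /typical_degree; case: eqP => [A1|_].
  under eq_fun do rewrite -ltNge.
  have := Kp_degree_lower_tail Ak; rewrite A1 => /le_trans; apply.
  by rewrite ler_expR; have := mean_ge; lra.
under eq_fun do rewrite -ltNge.
exact: Kp_degree_upper_tail.
Qed.

Lemma Kp_prob_typical_degrees_ge t : (0 < n)%N -> (t < k)%N ->
  2 - expR n%:R^-1 <= Kp_prob k p (typical_degrees t).
Proof.
move=> n0 tk; have n0R : n%:R != 0 :> R by rewrite pnatr_eq0 -lt0n.
suff : Kp_prob k p (predC (typical_degrees t)) <= expR n%:R^-1 - 1.
  by rewrite (Kp_prob_predC k p (typical_degrees t)); lra.
apply: le_trans (_ : \sum_(A : {set 'I_n} | (0 < #|A| <= t.+1)%N)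
    Kp_prob k p (fun G => ~~ typical_degree G A) <= _).
  apply: Kp_prob_union => // G _ /forallPn[A]; rewrite negb_imply => /andP[At nG].
  by exists A.
have invn_ge0 : 0 <= n%:R ^- 2 :> R by rewrite invr_ge0 exprn_ge0.
apply: le_trans (_ : (1 + n%:R ^- 2) ^+ n - 1 <= _).
  rewrite -[X in (1 + _) ^+ X]card_ord -sum_expr_card_subset.
  rewrite [X in _ <= X - 1](bigD1 set0) //= cards0 expr0 addrAC subrr add0r.
  rewrite [X in X <= _]big_mkcond [X in _ <= X]big_mkcond /=.
  apply: ler_sum => A _; case: ifP => [/andP[A0 At]|_].
    rewrite -card_gt0 A0; apply: Kp_prob_atypical_degree_le; rewrite -?card_gt0 //.
    exact: leq_trans At tk.
  by case: ifP => // _; rewrite exprn_ge0.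
rewrite lerD2r; apply: le_trans (_ : expR (n%:R ^- 2) ^+ n <= _).
  by rewrite lerXn2r ?nnegrE ?expR_ge0 ?expR_ge1Dx // addr_ge0.
by rewrite -expRM_natl ler_expR expr2 invfM mulrA mulfV ?mul1r.
Qed.
End DegreeTails.

(** * The parameter range of the theorem *)

Lemma bin_sub_le_expr (R : numFieldType) (n k i : nat) : (i < k <= n)%N ->
  'C(n - i.+1, k - i.+1)%:R <= 'C(n.-1, k.-1)%:R * (k%:R / n%:R) ^+ i :> R.
Proof.
case/andP => ik kn; elim: i ik => [|i IH] ik; first by rewrite expr0 mulr1 !subn1.
apply: le_trans (_ : 'C(n - i.+1, k - i.+1)%:R * (k%:R / n%:R) <= _); last first.
  by rewrite exprSr [X in _ <= X]mulrA ler_wpM2r ?divr_ge0 ?ler0n // IH // ltnW.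
have n0 : (0 < n)%N by apply: leq_trans kn; apply: leq_trans ik.
rewrite mulrA ler_pdivlMr ?ltr0n // -!natrM ler_nat.
have := mul_bin_diag (n - i.+1) (k - i.+2).
rewrite subnSK // -subnS; move: ('C(n - i.+2, k - i.+2)) 'C(_, _) => a b E.
have ni : (0 < n - i.+1)%N by rewrite subn_gt0 (leq_trans ik).
rewrite -(leq_pmul2l ni) mulnA E -mulnA mulnCA [X in (_ <= X)%N]mulnCA.
rewrite leq_mul2l; apply/orP; right.
by rewrite !mulnBl [(n * k)%N]mulnC leq_sub2l // leq_mul2l kn orbT.
Qed.

Lemma sum_expr_le (R : numDomainType) (x : R) (t : nat) : 0 <= x ->
  (1 - x) * \sum_(1 <= i < t) x ^+ i <= x.
Proof.
move=> x0; case: t => [|t]; first by rewrite big_geq // mulr0.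
rewrite big_add1 big_mkord /=; under eq_bigr do rewrite exprS.
rewrite -mulr_sumr mulrCA -opprB mulNr -subrX1 opprB ler_piMr //.
by rewrite gerBl exprn_ge0.
Qed.

Section DegreeComparison.
Variables (R : realType) (n k s t : nat) (p : R).
Hypotheses (t_gt1 : (1 < t)%N) (le_tk : (10 * t <= k)%N) (s_gt0 : (0 < s)%N)
  (n_ge : (k * (56 * (k ^ 2 * s)) ^ t <= n ^ t)%N) (p_ge0 : 0 <= p).

Lemma regime_k_ge20 : (20 <= k)%N.
Proof. by apply: leq_trans le_tk; rewrite (leq_mul2l 10 2). Qed.

Lemma regime_lt_tk : (t < k)%N.
Proof. by apply: leq_trans le_tk; rewrite ltn_Pmull // ltnW. Qed.

Lemma regime_n_ge : (56 * (k ^ 2 * s) <= n)%N.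
Proof.
rewrite -(leq_exp2r _ _ (ltnW t_gt1)); apply: leq_trans n_ge.
by rewrite leq_pmull // (leq_trans _ regime_k_ge20).
Qed.

Lemma regime_le_kn : (k <= n)%N.
Proof.
apply: leq_trans regime_n_ge; rewrite expnS expn1 -!mulnA mulnCA leq_pmulr //.
by rewrite !muln_gt0 s_gt0 (leq_trans _ regime_k_ge20).
Qed.

Lemma regime_le_sn : (s <= n)%N.
Proof.
apply: leq_trans regime_n_ge; rewrite mulnA leq_pmull //.
by rewrite muln_gt0 expn_gt0 (leq_trans _ regime_k_ge20).
Qed.

Lemma regime_n_gt0 : (0 < n)%N.
Proof. by apply: leq_trans regime_le_kn; apply: leq_trans regime_k_ge20. Qed.

Lemma regime_ln_gt0 : 0 < ln n%:R :> R.
Proof.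
rewrite ln_gt0 // ltr1n (leq_trans _ regime_le_kn) //.
exact: leq_trans regime_k_ge20.
Qed.

(* The loss factor of one branching step: each set has k s extensions, and each
   extension is contained in a proportion k / n of the edges. *)
Let ratio : R := k%:R ^+ 2 * s%:R / n%:R.

Lemma regime_ratio_ge0 : 0 <= ratio.
Proof. by rewrite divr_ge0 ?mulr_ge0 ?exprn_ge0. Qed.

Lemma regime_ratio_le : 56 * ratio <= 1.
Proof.
rewrite mulrA ler_pdivrMr ?ltr0n ?regime_n_gt0 // mul1r.
by rewrite -natrX -!natrM ler_nat regime_n_ge.
Qed.

Lemma regime_expr_ratio_le : k%:R * (56 * ratio) ^+ t <= 1.
Proof.
have nt0 : 0 < n%:R ^+ t :> R by rewrite exprn_gt0 // ltr0n regime_n_gt0.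
rewrite mulrA expr_div_n mulrA ler_pdivrMr // mul1r.
by rewrite -[k%:R ^+ 2]natrX -!natrM -!natrX -natrM ler_nat.
Qed.

Local Notation mu := (mean_degree n k p).

Lemma mean_degree_le i : (i < k)%N -> mu i.+1 <= mu 1%N * (k%:R / n%:R) ^+ i.
Proof.
move=> ik; rewrite /mean_degree !subn1 -mulrA ler_wpM2l // bin_sub_le_expr //.
by rewrite ik regime_le_kn.
Qed.

Hypothesis mean_ge :
  8 * (t%:R + 1) * k%:R ^+ t.+1 * s%:R ^+ t * ln n%:R <= mu 1%N.

Lemma mean_degree_ge_ln c : (c <= 8 * t.+1 * k ^ t.+1 * s ^ t)%N ->
  c%:R * ln n%:R <= mu 1%N.
Proof.
move=> le_c; apply: le_trans mean_ge; rewrite ler_wpM2r ?(ltW regime_ln_gt0) //.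
by rewrite natr1 -!natrX -!natrM ler_nat.
Qed.

Lemma mean_degree1_gt0 : 0 < mu 1%N.
Proof.
apply: lt_le_trans mean_ge; rewrite natr1 -!natrX -!natrM.
rewrite mulr_gt0 ?regime_ln_gt0 // ltr0n !muln_gt0 !expn_gt0 s_gt0.
by rewrite (leq_trans _ regime_k_ge20).
Qed.

Lemma mean_degree_ge_shallow_ln :
  800 * (t%:R ^+ 3 * (k * s)%:R ^+ t.-1 * ln n%:R) <= mu 1%N.
Proof.
have t0 := ltnW t_gt1.
rewrite mulrA -!natrX -!natrM; apply: mean_degree_ge_ln.
have -> : (k ^ t.+1 = k ^ 2 * k ^ t.-1)%N by rewrite -expnD -{1}(prednK t0).
have -> : (s ^ t = s * s ^ t.-1)%N by rewrite -expnS prednK.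
have -> : (8 * t.+1 * (k ^ 2 * k ^ t.-1) * (s * s ^ t.-1)
  = 8 * (t.+1 * k ^ 2 * s) * (k * s) ^ t.-1)%N by rewrite expnMn; ring.
rewrite mulnA leq_mul2r; apply/orP; right.
have -> : (800 * t ^ 3 = 8 * (t * (10 * t) ^ 2))%N by ring.
rewrite leq_mul2l /=; apply: leq_trans (leq_pmulr _ s_gt0).
by rewrite leq_mul ?leqnSn // leq_exp2r.
Qed.

Lemma mean_degree_ge_s_ln : 480 * (s%:R * ln n%:R) <= mu 1%N.
Proof.
rewrite mulrA -natrM; apply: mean_degree_ge_ln; apply: leq_mul; last first.
  by rewrite -{1}(expn1 s) leq_pexp2l // ltnW.
rewrite (_ : 480 = 8 * 3 * 20)%N // leq_mul // ?leq_mul //.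
apply: leq_trans regime_k_ge20 _; rewrite -{1}(expn1 k) leq_pexp2l //.
exact: leq_trans regime_k_ge20.
Qed.

Section Costs.
Variable D : nat -> nat.
Hypothesis D_le : forall i, (1 < i <= t.+1)%N -> (D i)%:R <= degree_cap n k p i.

Lemma level_cost_le j : (0 < j <= t)%N ->
  (k * s)%:R ^+ j * (D j.+1)%:R
    <= 3 * mu 1%N * ratio ^+ j + 2 * j.+1%:R * (k * s)%:R ^+ j * ln n%:R.
Proof.
case/andP=> j0 jt; set m := (k * s)%:R ^+ j.
have m0 : 0 <= m by rewrite exprn_ge0.
have mu_le : m * mu j.+1 <= mu 1%N * ratio ^+ j.
  rewrite (_ : ratio ^+ j = m * (k%:R / n%:R) ^+ j); last first.
    by rewrite -exprMn natrM /ratio; congr (_ ^+ j); ring.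
  rewrite [X in _ <= X]mulrCA ler_wpM2l // mean_degree_le //.
  by rewrite (leq_ltn_trans jt) // regime_lt_tk.
have := ler_wpM2l m0 (D_le (i := j.+1) _); rewrite !ltnS j0 jt => /(_ isT).
by rewrite /degree_cap; lra.
Qed.

Lemma shallow_level_cost_le i : (1 <= i < t)%N ->
  i.+1%:R * ((k * s)%:R ^+ i * (D i.+1)%:R)
    <= 3 * mu 1%N * (1 / 28) ^+ i
       + 2 * (t%:R ^+ 2 * (k * s)%:R ^+ t.-1 * ln n%:R).
Proof.
have mu0 := mean_degree1_gt0; have ratio0 := regime_ratio_ge0.
case/andP=> i0 it; have := @level_cost_le i; rewrite i0 ltnW // => /(_ isT) lev.
apply: le_trans (ler_wpM2l (ler0n _ i.+1) lev) _; rewrite mulrDr; apply: lerD.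
  rewrite mulrCA ler_wpM2l ?mulr_ge0 ?(ltW mu0) //.
  apply: (@le_trans _ _ (2 ^+ i * ratio ^+ i)).
    by rewrite ler_wpM2r ?exprn_ge0 // -natrX ler_nat ltn_expl.
  by rewrite -exprMn lerXn2r ?nnegrE //; have := regime_ratio_le; lra.
rewrite (_ : i.+1%:R * _ = 2 * (i.+1%:R ^+ 2 * (k * s)%:R ^+ i * ln n%:R));
  last by ring.
rewrite ler_wpM2l // ler_wpM2r ?(ltW regime_ln_gt0) // ler_pM ?exprn_ge0 //.
  by rewrite lerXn2r ?nnegrE // ler_nat.
rewrite ler_weXn2l //; last by rewrite -ltnS prednK // ltnW.
by rewrite ler1n muln_gt0 s_gt0 (leq_trans _ regime_k_ge20).
Qed.

Lemma shallow_cost_le :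
  \sum_(1 <= i < t) i.+1%:R * ((k * s)%:R ^+ i * (D i.+1)%:R)
    <= (1 / 9 + 1 / 400) * mu 1%N.
Proof.
have mu0 := mean_degree1_gt0.
set y := t%:R ^+ 2 * (k * s)%:R ^+ t.-1 * ln n%:R : R.
apply: (@le_trans _ _ (\sum_(1 <= i < t) (3 * mu 1%N * (1 / 28) ^+ i + 2 * y))).
  by rewrite !big_nat; apply: ler_sum => i; apply: shallow_level_cost_le.
rewrite big_split /= -mulr_sumr sumr_const_nat -[2 * y *+ _]mulr_natl.
rewrite [X in _ <= X]mulrDl; apply: lerD.
  have : (1 - 1 / 28) * \sum_(1 <= i < t) (1 / 28) ^+ i <= 1 / 28 :> R.
    by rewrite sum_expr_le.
  by set S := \sum_(_ <= _ < _) _; nra.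
have y0 : 0 <= y by rewrite !mulr_ge0 ?exprn_ge0 // ltW // regime_ln_gt0.
have : (t - 1)%:R * (2 * y) <= t%:R * (2 * y).
  by apply: ler_wpM2r; [apply: mulr_ge0 | rewrite ler_nat leq_subr].
have : 800 * (t%:R * y) <= mu 1%N.
  by have := mean_degree_ge_shallow_ln; rewrite /y exprS -!mulrA.
lra.
Qed.

Lemma deep_cost_le :
  k%:R * ((k * s)%:R ^+ t * (D t.+1)%:R) <= (3 / 3136 + 1 / 4) * mu 1%N.
Proof.
have mu0 := mean_degree1_gt0; have ratio0 := regime_ratio_ge0.
have lev := @level_cost_le t; rewrite leqnn ltnW // in lev.
apply: le_trans (ler_wpM2l (ler0n _ k) (lev isT)) _.
rewrite mulrDr [X in _ <= X]mulrDl; apply: lerD; last first.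
  rewrite (_ : k%:R * _ =
    (8 * (t%:R + 1) * k%:R ^+ t.+1 * s%:R ^+ t * ln n%:R) / 4); last first.
    by rewrite -natr1 natrM exprMn exprS; field.
  by have := mean_ge; lra.
have ratio_t_le : 3136 * (k%:R * ratio ^+ t) <= 1.
  apply: le_trans regime_expr_ratio_le.
  rewrite [(56 * _) ^+ t]exprMn [X in _ <= X]mulrCA.
  rewrite ler_wpM2r ?mulr_ge0 ?exprn_ge0 //.
  by rewrite (_ : 3136 = 56 ^+ 2) ?ler_weXn2l //; [lra | ring].
by rewrite mulrCA; nra.
Qed.

Lemma pair_cost_le :
  s%:R * (D 2)%:R <= (3 / 1120 + 1 / 120) * mu 1%N.
Proof.
have mu0 := mean_degree1_gt0.
have k20 : 20 <= k%:R :> R by rewrite (ler_nat R 20) regime_k_ge20.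
have k0 : 0 < k%:R :> R by lra.
have ratio_mu_le : mu 1%N * (56 * ratio) <= mu 1%N.
  by rewrite ler_piMr ?regime_ratio_le // ltW.
have k_mu_ge : 20 * mu 1%N <= k%:R * mu 1%N by rewrite ler_wpM2r // ltW.
have k_ln_le := ler_wpM2l (ltW k0) mean_degree_ge_s_ln.
rewrite -(ler_pM2l k0).
by have := @level_cost_le 1 (ltnW t_gt1); rewrite !expr1 natrM; lra.
Qed.

Lemma avoidance_bound_lt :
  (avoidance_bound k s t D + s * D 2)%:R < 2 / 5 * mu 1%N.
Proof.
have : (avoidance_bound k s t D + s * D 2)%:R =
    \sum_(1 <= i < t) i.+1%:R * ((k * s)%:R ^+ i * (D i.+1)%:R)
    + k%:R * ((k * s)%:R ^+ t * (D t.+1)%:R) + s%:R * (D 2)%:R :> R.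
  rewrite !natrD natr_sum !natrM !natrX -!mulrA !natrM.
  by congr (_ + _ + _); apply: eq_bigr => i _; rewrite !natrM natrX natrM -mulrA.
have := shallow_cost_le; have := deep_cost_le; have := pair_cost_le.
by have := mean_degree1_gt0; lra.
Qed.
End Costs.

Lemma max_degree_le_cap (G : {set {set 'I_n}}) : typical_degrees k p t G ->
  forall i, (1 < i <= t.+1)%N -> (max_degree G i)%:R <= degree_cap n k p i.
Proof.
move=> typG i /andP[i1 it]; have cap0 : 0 <= degree_cap n k p i.
  by rewrite addr_ge0 ?mulr_ge0 // ltW // regime_ln_gt0.
rewrite -truncn_ge_nat //; apply/bigmax_leqP => A /eqP Ai.
rewrite truncn_ge_nat // -Ai.
have := typical_degreesP typG (A := A); rewrite /typical_degree Ai it.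
by rewrite (ltn_trans _ i1) // gtn_eqF // => /(_ isT).
Qed.

Lemma typical_degrees_nontrivial_beaten (G : {set {set 'I_n}}) :
  G \subset complete_hypergraph 'I_n k -> typical_degrees k p t G ->
  nontrivial_beaten s G.
Proof.
move=> GH typG; have Gk : {in G, forall E : {set 'I_n}, #|E| = k}.
  by move=> E /(subsetP GH); rewrite inE => /eqP.
apply: (degree_gt_nontrivial_beaten (k := k)) t_gt1 _ => [|E /Gk->//||x].
- by apply/negP => /Gk; rewrite cards0 => k0; move: regime_k_ge20; rewrite -k0.
- by rewrite card_ord regime_le_sn.
rewrite -(ltr_nat R).
apply: lt_le_trans (avoidance_bound_lt (max_degree_le_cap typG)) _.
have := typical_degreesP typG (A := [set x]).
by rewrite /typical_degree cards1 eqxx; apply.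
Qed.

Lemma Kp_prob_nontrivial_beaten_ge : p <= 1 ->
  2 - expR n%:R^-1 <= Kp_prob k p (@nontrivial_beaten 'I_n s).
Proof.
move=> p_le1; have p01 : 0 <= p <= 1 by rewrite p_ge0.
apply: le_trans (_ : Kp_prob k p (typical_degrees k p t) <= _).
  apply: Kp_prob_typical_degrees_ge => //; last exact: regime_lt_tk.
    have ln_le : ln n%:R <= s%:R * ln n%:R :> R.
      by rewrite ler_peMl ?ler1n // ltW // regime_ln_gt0.
    by have := mean_degree_ge_s_ln; have := regime_ln_gt0; lra.
  exact: regime_n_gt0.
by apply: Kp_prob_le => // G; apply: typical_degrees_nontrivial_beaten.
Qed.
End DegreeComparison.

Lemma regime_of_powR (R : realType) (n k s t : nat) : (0 < t)%N -> (0 < k)%N ->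
  56 * k%:R `^ (2 + 1 / t%:R) * s%:R <= n%:R :> R ->
  (k * (56 * (k ^ 2 * s)) ^ t <= n ^ t)%N.
Proof.
move=> t0 k0 n_ge; rewrite -(ler_nat R) natrX natrM natrX 2!natrM natrX.
have t0R : t%:R != 0 :> R by rewrite pnatr_eq0 -lt0n.
have root_expr : (k%:R `^ (1 / t%:R)) ^+ t = k%:R :> R.
  by rewrite -powR_mulrn ?powR_ge0 // -powRrM div1r mulVf // powRr1.
rewrite -[X in X * _]root_expr -exprMn.
rewrite lerXn2r ?nnegrE ?mulr_ge0 ?exprn_ge0 ?powR_ge0 //.
apply: le_trans n_ge; rewrite powRD ?pnatr_eq0 -?lt0n ?k0 ?implybT //.
by rewrite powR_mulrn //; lra.
Qed.

Lemma mean_degree1_ge (R : realType) (n k : nat) (p x : R) : (k <= n)%N ->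
  x / 'C(n.-1, k.-1)%:R <= p -> x <= mean_degree n k p 1.
Proof.
move=> kn; rewrite /mean_degree !subn1 -ler_pdivrMr // ltr0n bin_gt0.
by rewrite -!subn1 leq_sub2r.
Qed.

Local Open Scope classical_set_scope.
Local Open Scope ring_scope.

Lemma cvg_sub_expR_invn (R : realType) :
  (2 - expR n%:R^-1 : R) @[n --> \oo] --> (1 : R).
Proof.
rewrite [X in _ --> X](_ : 1 = 2 - expR 0 :> R); last by rewrite expR0; lra.
apply: cvgB; first exact: cvg_cst.
apply: continuous_cvg; first exact: continuous_expR.
by rewrite -(cvg_shiftS (fun n : nat => n%:R^-1 : R)) /=; apply: cvg_harmonic.
Qed.

Theorem theorem1p4 (R : realType) (t s k : nat -> nat) (p : nat -> R)
    (ht : forall n : nat, (2 <= t n)%N)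
    (htk : (t n)%:R / (k n)%:R @[n --> \oo] --> (0 : R))
    (hs : forall n : nat, (0 < s n)%N)
    (hk : forall n : nat, (0 < k n)%N)
    (hp : \forall n \near \oo,
       8 * ((t n)%:R + 1) * (k n)%:R ^+ (t n).+1 * (s n)%:R ^+ t n * ln n%:R
         / 'C(n.-1, (k n).-1)%:R <= p n <= 1)
    (hn : \forall n \near \oo,
       56 * (k n)%:R `^ (2 + 1 / (t n)%:R) * (s n)%:R <= (n%:R : R)
         <= 56 * (k n)%:R `^ (2 + 1 / ((t n)%:R - 1)) * (s n)%:R) :
  Kp_prob (k n) (p n) (fun G : {set {set 'I_n}} =>
    [forall F : {set {set 'I_n}},
      [&& F \subset G, nontrivial F & (matching_number F <= s n)%N] ==>
      [exists S : {set 'I_n},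
        (#|S| == s n) && (#|F| < #|edges_meeting G S|)%N]])
    @[n --> \oo] --> (1 : R).
Proof.
have htk10 : \forall n \near \oo, (t n)%:R / (k n)%:R < 1 / 10 :> R.
  by apply: (cvgr_lt 0 htk); lra.
apply: (squeeze_cvgr (h := fun=> 1) _ (@cvg_sub_expR_invn R)); last exact: cvg_cst.
apply: filterS3 htk10 hp hn => n ltk /andP[p_ge p_le1] /andP[n_ge _].
have le_tk : (10 * t n <= k n)%N.
  rewrite -(ler_nat R) natrM; move: ltk; rewrite ltr_pdivrMr ?ltr0n //; lra.
have expn_ge := regime_of_powR (ltnW (ht n)) (hk n) n_ge.
have p_ge0 : 0 <= p n.
  apply: le_trans p_ge; rewrite divr_ge0 ?mulr_ge0 ?exprn_ge0 ?ln_ge0 //.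
  by rewrite ler1n (regime_n_gt0 (ht n) le_tk (hs n) expn_ge).
have mean_ge := mean_degree1_ge (regime_le_kn (ht n) le_tk (hs n) expn_ge) p_ge.
rewrite Kp_prob_le1 ?p_ge0 // andbT.
exact: Kp_prob_nontrivial_beaten_ge (ht n) le_tk (hs n) expn_ge p_ge0 mean_ge p_le1.
Qed.
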